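(* Let $G$ be the discrete Heisenberg group, i.e. the group of matrices $\begin{pmatrix}1&k&m\\0&1&n\\0&0&1\end{pmatrix}$ with $k,m,n\in\mathbb{Z}$, with the standard generating set $\{a^{\pm1},b^{\pm1}\}$, where $a=\begin{pmatrix}1&1&0\\0&1&0\\0&0&1\end{pmatrix}$ and $b=\begin{pmatrix}1&0&0\\0&1&1\\0&0&1\end{pmatrix}$. Let $\{B_n\}$ be the associated sequence of balls. Then there is no subsequence $\{B_{n(i)}\}_{i=1}^\infty$ of balls along which the ratio ergodic theorem holds.
   Context: The ball $B_n$ with respect to a finite symmetric generating set is the set of elements that are products of at most $n$ generators. Let $G$ act from the left by measure-preserving transformations $x\mapsto T^g x$. For finite $F\subseteq G$ put $S_F(\varphi)=\sum_{g\in F}\varphi\circ T^g$ and $R_F(\varphi,\psi)=S_F(\varphi)/S_F(\psi)$ (where the denominator is nonzero). The ratio ergodic theorem holds along a sequence $\{F_n\}$ of finite subsets of $G$ if for every ergodic measure-preserving action of $G$ on a non-atomic $\sigma$-finite measure space $(X,\mathcal{B},\mu)$ and all $\varphi,\psi\in L^1(\mu)$ with $\int\psi\,d\mu\ne 0$, we have $R_{F_n}(\varphi,\psi)\to \int\varphi\,d\mu/\int\psi\,d\mu$ $\mu$-a.e. *)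

(* Defs.v *)
From HB Require Import structures.
From mathcomp Require Import all_boot all_order all_algebra.
From mathcomp Require Import finmap.
From mathcomp Require Import all_classical all_reals all_analysis.
From mathcomp Require Import ring.

Set Implicit Arguments.
Unset Strict Implicit.
Unset Printing Implicit Defensive.

Import Order.TTheory GRing.Theory Num.Theory.
Import numFieldNormedType.Exports.

Local Open Scope classical_set_scope.
Local Open Scope ring_scope.

Section Balls.
Variable G : groupType.

Definition word_ball_set (S : {fset G}) (n : nat) : set G :=
  [set g | exists s : seq G,
    [/\ (size s <= n)%N, {in s, forall x, x \in S} & g = (\prod_(x <- s) x)%g]].

Lemma finite_word_ball_set (S : {fset G}) (n : nat) :
  finite_set (word_ball_set S n).
Proof.
elim: n => [|n IHn].
  apply: (@sub_finite_set _ _ [set 1%g]); last exact: finite_set1.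
  by move=> g [s [+ _ ->]]; rewrite leqn0 size_eq0 => /eqP ->; rewrite big_nil.
apply: (@sub_finite_set _ _ (1%g |` [set (x * h)%g |
    x in [set` S] & h in word_ball_set S n])); last first.
  by rewrite finite_setU; split; [exact: finite_set1|exact: finite_image2].
move=> g [[|x s] [/= sn sS ->]]; first by left; rewrite big_nil.
right; rewrite big_cons.
exists x; first by rewrite /= sS ?mem_head.
exists (\prod_(y <- s) y)%g => //; exists s; split=> // y ys.
by apply: sS; rewrite inE ys orbT.
Qed.

(* [fset_set] sends infinite sets to [fset0]; [finite_word_ball_set] rules
   this case out, see [in_word_ball]. *)
Definition word_ball (S : {fset G}) (n : nat) : {fset G} :=
  fset_set (word_ball_set S n).

Lemma in_word_ball (S : {fset G}) (n : nat) (g : G) :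
  g \in word_ball S n <-> word_ball_set S n g.
Proof.
rewrite in_fset_set; last exact: finite_word_ball_set.
by split => [/set_mem|/mem_set].
Qed.

End Balls.

Section Actions.
Context {d : measure_display} {X : measurableType d} {R : realType}.

Definition non_atomic (mu : set X -> \bar R) : Prop :=
  ~ exists A : set X, [/\ measurable A, (0 < mu A)%E &
      forall B : set X, measurable B -> B `<=` A ->
        mu B = 0%E \/ mu (A `\` B) = 0%E].

Definition measure_preserving (mu : set X -> \bar R) (f : X -> X) : Prop :=
  measurable_fun setT f /\
  forall A : set X, measurable A -> mu (f @^-1` A) = mu A.

Definition mp_action (G : groupType) (mu : set X -> \bar R) (T : G -> X -> X)
    : Prop :=
  [/\ forall x, T 1%g x = x,
      forall g h x, T (g * h)%g x = T g (T h x) &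
      forall g, measure_preserving mu (T g)].

Definition ergodic (G : groupType) (mu : set X -> \bar R) (T : G -> X -> X)
    : Prop :=
  forall A : set X, measurable A -> (forall g, T g @^-1` A = A) ->
    mu A = 0%E \/ mu (~` A) = 0%E.

Definition orbit_sum (G : groupType) (T : G -> X -> X) (F : {fset G})
  (phi : X -> R) (x : X) : R := \sum_(g <- F) phi (T g x).

Definition orbit_ratio (G : groupType) (T : G -> X -> X) (F : {fset G})
    (phi psi : X -> R) (x : X) : R :=
  orbit_sum T F phi x / orbit_sum T F psi x.

End Actions.

(* The ratio is only considered where its denominator is nonzero, hence the
   restriction of the limit to such indices. When all the [F n] are nonempty,
   the property below forces the denominators to be nonzero for all
   large n almost everywhere: compare psi with an everywhere positive
   integrable function. *)
Definition ratio_ergodic_theorem_along (R : realType) (G : groupType)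
    (F : nat -> {fset G}) : Prop :=
  forall (d : measure_display) (X : measurableType d)
    (mu : {sigma_finite_measure set X -> \bar R}) (T : G -> X -> X),
    non_atomic mu -> mp_action mu T -> ergodic mu T ->
  forall phi psi : X -> R,
    mu.-integrable setT (EFin \o phi) -> mu.-integrable setT (EFin \o psi) ->
    \int[mu]_x psi x != 0 ->
  {ae mu, forall x,
    orbit_ratio T (F n) phi psi x
      @[n --> within [set n | orbit_sum T (F n) psi x != 0] \oo]
      --> \int[mu]_x phi x / \int[mu]_x psi x}.

Definition heis_mx (k m n : int) : 'M[int]_3 :=
  \matrix_(i, j) nth 0 (nth [::] [:: [:: 1; k; m];
                                     [:: 0; 1; n];
                                     [:: 0; 0; 1]] i) j.

Definition is_heis (M : 'M[int]_3) : bool :=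
  M == heis_mx (M 0 1) (M 0 2) (M 1 2).

Lemma is_heisP (M : 'M[int]_3) :
  reflect (exists k m n, M = heis_mx k m n) (is_heis M).
Proof.
apply: (iffP eqP) => [->|[k [m [n ->]]]]; first by do 3 eexists.
by rewrite !mxE.
Qed.

Lemma is_heis_mx (k m n : int) : is_heis (heis_mx k m n).
Proof. by apply/is_heisP; exists k, m, n. Qed.

Lemma heis_mxM (k m n k' m' n' : int) :
  heis_mx k m n *m heis_mx k' m' n' = heis_mx (k + k') (m + m' + k * n') (n + n').
Proof.
apply/matrixP => i j; rewrite !mxE !big_ord_recr big_ord0 /= !mxE /=.
case: i => [[|[|[|//]]] ?]; case: j => [[|[|[|//]]] ?] /=; ring.
Qed.

Lemma heis_mx1 : heis_mx 0 0 0 = 1%:M.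
Proof.
apply/matrixP => i j; rewrite !mxE.
by case: i => [[|[|[|//]]] ?]; case: j => [[|[|[|//]]] ?].
Qed.

Record heisenberg := Heisenberg { heis_val :> 'M[int]_3; _ : is_heis heis_val }.

HB.instance Definition _ := [isSub for heis_val].
HB.instance Definition _ := [Choice of heisenberg by <:].

Definition heis (k m n : int) : heisenberg := Heisenberg (is_heis_mx k m n).

Lemma heisE (x : heisenberg) : exists k m n, x = heis k m n.
Proof.
have /is_heisP [k [m [n e]]] := valP x.
by exists k, m, n; apply: val_inj.
Qed.

Lemma is_heis_one : is_heis 1%:M.
Proof. by rewrite -heis_mx1 is_heis_mx. Qed.

Lemma is_heis_mul (x y : heisenberg) : is_heis (heis_val x *m heis_val y).
Proof.
have [k [m [n ->]]] := heisE x; have [k' [m' [n' ->]]] := heisE y.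
by rewrite heis_mxM is_heis_mx.
Qed.

Definition heis_one : heisenberg := Heisenberg is_heis_one.

Definition heis_mul (x y : heisenberg) : heisenberg :=
  Heisenberg (is_heis_mul x y).

Definition heis_inv (x : heisenberg) : heisenberg :=
  heis (- heis_val x 0 1)
       (heis_val x 0 1 * heis_val x 1 2 - heis_val x 0 2)
       (- heis_val x 1 2).

Lemma heis_mulA : associative heis_mul.
Proof. by move=> x y z; apply: val_inj; rewrite /= mulmxA. Qed.

Lemma heis_mul1g : left_id heis_one heis_mul.
Proof. by move=> x; apply: val_inj; rewrite /= mul1mx. Qed.

Lemma heis_mulg1 : right_id heis_one heis_mul.
Proof. by move=> x; apply: val_inj; rewrite /= mulmx1. Qed.

Lemma heis_mulVg : left_inverse heis_one heis_inv heis_mul.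
Proof.
move=> x; have [k [m [n ->]]] := heisE x; apply: val_inj.
rewrite /= heis_mxM !mxE /= -heis_mx1; congr heis_mx; ring.
Qed.

Lemma heis_mulgV : right_inverse heis_one heis_inv heis_mul.
Proof.
move=> x; have [k [m [n ->]]] := heisE x; apply: val_inj.
rewrite /= heis_mxM !mxE /= -heis_mx1; congr heis_mx; ring.
Qed.

HB.instance Definition _ := isGroup.Build heisenberg
  heis_mulA heis_mul1g heis_mulg1 heis_mulVg heis_mulgV.

Definition heis_a : heisenberg := heis 1 0 0.
Definition heis_b : heisenberg := heis 0 0 1.

Definition heis_gens : {fset heisenberg} :=
  [fset heis_a; heis_a^-1; heis_b; heis_b^-1]%g%fset.

(* Main.v *)
Require Import Defs.
From HB Require Import structures.
From mathcomp Require Import all_boot all_order all_algebra.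
From mathcomp Require Import finmap.
From mathcomp Require Import all_classical all_reals all_analysis.
From mathcomp Require Import zify ring lra.

(** Non-convergence comes from one feature of the word metric of the Heisenberg
group.  Write [c] for the central element with coordinates (0, 1, 0).  Closed
paths of length [n] in the plane enclose an area of at most n^2 / 16, so [c^t]
lies in the ball of radius [n] only if [16 |t| <= n^2]; but a path that ends
four units to the right of its origin is closed up by four steps that it need
not pay for, so that [a^4 c^t] lies in that ball for all [|t|] below roughly
(n + 4)^2 / 16.  Seen from the coset of [a^4], the ball of radius [n] therefore
reaches further along the centre than it does in its own coset, by a window of
length about n / 2, which is as large as one likes when [n] is large.

An infinite measure preserving action exploits this window.  It is built by
cutting and stacking: start from a column of mass one, and at stage [M] cut all
columns in two halves and place the right half at the position of the left one,
translated by a group element [s_M] that is far from everything built so far.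
Let [A] be the column of mass one.  From a point of [A], the visits to [A] are
indexed by the differences of words in [s_0, s_1, ...].  Given the radii [u],
take [s_M = c^tau_M] with [tau_M] in the window that belongs to a radius
[n = u i] that is huge compared with all earlier choices.  The ball of radius
[n] then sees at most 2^M visits to [A] (isoperimetry excludes [s_M] and all
later spacers), and at least 2^(M+1) visits to the translate of [A] by [a^4].
Both sets have mass one, so the ratio ought to converge to 1, yet it is at least
2 infinitely often, at every point of the first column.

The construction is carried out for any group: [cf_data] lists what the spacers
and the exhausting finite windows must satisfy, the resulting action is shown to
be measure preserving ([cf_mp_action]), ergodic ([cf_ergodic]), non-atomic
([cf_non_atomic]) and sigma-finite ([cf_sigma_finite]), and
[ratio_ergodic_fails] is the counting argument.  The Heisenberg group enters
through [heis_c_isoperimetric] and [heis_reach]. *)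

Set Implicit Arguments.
Unset Strict Implicit.
Unset Printing Implicit Defensive.

Import Order.TTheory GRing.Theory Num.Theory.
Import numFieldNormedType.Exports.

Local Open Scope classical_set_scope.
Local Open Scope ring_scope.

(** * Dyadic intervals *)

Section Dyadic.
Context {R : realType}.

Definition dyadic (n : nat) : set R := `[0, 2 ^- n[.

Lemma dyadic_length_gt0 n : 0 < 2 ^- n :> R.
Proof. by rewrite invr_gt0 exprn_gt0. Qed.

Lemma dyadic_lengthS n : 2 ^- n = 2 ^- n.+1 + 2 ^- n.+1 :> R.
Proof. rewrite exprS invfM; field. by rewrite expf_neq0. Qed.

Lemma dyadicP n (w : R) : dyadic n w <-> 0 <= w < 2 ^- n.
Proof. by rewrite /dyadic /= in_itv. Qed.

Lemma dyadicS n : dyadic n.+1 `<=` dyadic n.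
Proof.
move=> w /dyadicP/andP[w0 w1]; apply/dyadicP.
have := dyadic_length_gt0 n.+1; have := dyadic_lengthS n; lra.
Qed.

Lemma dyadic_le m n : (m <= n)%N -> dyadic n `<=` dyadic m.
Proof.
elim: n => [|n IHn]; first by rewrite leqn0 => /eqP ->.
rewrite leq_eqVlt => /predU1P[-> //|/IHn mn].
exact: (subset_trans (@dyadicS n)).
Qed.

Lemma measurable_dyadic n : measurable (dyadic n).
Proof. exact: measurable_itv. Qed.

Lemma lebesgue_dyadic n : lebesgue_measure (dyadic n) = (2 ^- n)%:E.
Proof.
by rewrite /dyadic lebesgue_measure_itv /= lte_fin dyadic_length_gt0 oppr0 adde0.
Qed.

Lemma measurable_fun_translate (c : R) :
  measurable_fun setT (fun w : R => w - c).
Proof. exact: measurable_realfun.measurable_funB. Qed.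

Lemma measurable_translate (A : set R) (c : R) : measurable A ->
  measurable [set w | A (w - c)].
Proof.
move=> mA; rewrite -[X in measurable X]setTI.
exact: measurable_fun_translate.
Qed.

(** The image of Lebesgue measure under a translation agrees with it on half-open
intervals, which determine it. *)
Lemma lebesgue_translate (A : set R) (c : R) : measurable A ->
  lebesgue_measure [set w | A (w - c)] = lebesgue_measure A.
Proof.
move=> mA.
suff : pushforward lebesgue_measure
    (fun w : measurableTypeR R => w - c : measurableTypeR R) A
   = lebesgue_measure A by [].
apply/esym/lebesgue_measure_unique => //=; first exact: measurable_fun_translate.
move=> _.
move=> _ [[a b]] _ <-.
rewrite /pushforward.
have -> : (fun w : R => w - c) @^-1` `]a, b]%classic = `]a + c, b + c]%classic.
  by apply/seteqP; split => w; rewrite /= !in_itv /= ltrBrDr lerBlDr.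
by rewrite !lebesgue_measure_itv /= !lte_fin ltrD2r -!EFinD opprD addrACA subrr
  addr0.
Qed.
End Dyadic.

(** * The space of columns *)

(** A point (g, w) stands for the position [g] over the point [w] of the column
[0, 1[.  Cutting and stacking identifies points of this product; the
identifications are imposed on the sigma-algebra instead of the points, so that
left multiplication is an action everywhere.  The spacers [s] do not occur in
the carrier, but they index it since the sigma-algebra depends on them. *)
Definition cf_space (R : realType) (G : groupType) (s : nat -> G) : Type :=
  (G * R)%type.

Section Space.
Context (R : realType) {G : groupType} (s : nat -> G).

Local Notation X := (cf_space R s).

HB.instance Definition _ := Choice.copy X (G * R)%type.
HB.instance Definition _ := isPointed.Build X (1%g, 0).

Implicit Types (x : X) (E : set X) (g h : G).

Definition slice E g : set R := [set w | E (g, w)].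

(** One stage of cutting and stacking: the right half of the interval
[0, 2^-n[ is moved over the left half, at the position translated by [s n].  The
points [x] and [cut n x] represent the same point of the stacked space. *)
Definition cut (n : nat) x : X :=
  if x.2 < 2 ^- n.+1 then x else ((x.1 * s n)%g, x.2 - 2 ^- n.+1).

(** The sets with Borel slices that are saturated for the identifications. *)
Definition cf_measurable E :=
  (forall g, measurable (slice E g)) /\
  (forall n x, dyadic n x.2 -> (E x <-> E (cut n x))).

Let cf_measurable0 : cf_measurable set0.
Proof. by split=> [g|]; first exact: measurable0. Qed.

Let cf_measurableC E : cf_measurable E -> cf_measurable (~` E).
Proof.
case=> mE sE; split=> [g|n x /sE]; [exact: (measurableC (mE g))|].
by rewrite /setC /=; tauto.
Qed.

Let cf_measurable_bigcup (F : (set X)^nat) :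
  (forall i, cf_measurable (F i)) -> cf_measurable (\bigcup_i F i).
Proof.
move=> mF; split=> [g|n x nx].
  rewrite (_ : slice _ g = \bigcup_i slice (F i) g) //.
  by apply: bigcupT_measurable => i; exact: (mF i).1.
by split=> -[i _ /((mF i).2 n x nx) Fix]; exists i.
Qed.

HB.instance Definition _ := isMeasurable.Build default_measure_display X
  cf_measurable0 cf_measurableC cf_measurable_bigcup.

Lemma measurable_slice E g : measurable E -> measurable (slice E g).
Proof. by case=> + _; exact. Qed.

Lemma cutP E n x : measurable E -> dyadic n x.2 -> E x <-> E (cut n x).
Proof. by case=> _; exact. Qed.

Lemma cut_dyadic n x : dyadic n x.2 -> dyadic n.+1 (cut n x).2.
Proof.
case: x => g w /= /dyadicP/andP[w0 wn]; apply/dyadicP; rewrite /cut /=.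
case: ifPn => /= [->|]; first by rewrite w0.
by have := dyadic_lengthS (R := R) n; rewrite -leNgt => *; lra.
Qed.

Lemma cut_id n x : dyadic n.+1 x.2 -> cut n x = x.
Proof. by rewrite /cut => /dyadicP/andP[_ ->]. Qed.

Fixpoint reduce (n : nat) x : X :=
  if n is m.+1 then cut m (reduce m x) else x.

Lemma reduce_id n x : dyadic n x.2 -> reduce n x = x.
Proof.
elim: n x => //= n IHn x xn.
by rewrite IHn ?cut_id //; exact: dyadicS.
Qed.

(** Identified points have the same reductions from some stage on. *)
Lemma reduce_cut n m x : dyadic n x.2 -> (n < m)%N ->
  reduce m (cut n x) = reduce m x.
Proof.
move=> xn; elim: m => // m IHm; rewrite ltnS leq_eqVlt => /predU1P[<-|/IHm /= ->//].
rewrite reduce_id; last exact: cut_dyadic.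
by rewrite /= reduce_id.
Qed.

(** The map [cut n] is the identity on one half-line and, on the other one, a
translation combined with a change of slice. *)
Lemma measurable_slice_reduce n E : (forall g, measurable (slice E g)) ->
  forall g, measurable (slice (reduce n @^-1` E) g).
Proof.
elim: n E => //= n IHn E mE.
apply: (IHn (cut n @^-1` E)) => g.
have -> : slice (cut n @^-1` E) g =
    (slice E g `&` `]-oo, 2 ^- n.+1[) `|`
    ([set w | slice E (g * s n)%g (w - 2 ^- n.+1)] `&` `[2 ^- n.+1, +oo[).
  apply/seteqP; split => w; rewrite /slice /cut /= !in_itv /= andbT.
    by case: ltP => h; [left|right].
  by case=> -[+ h]; [rewrite h|rewrite ltNge h].
apply: measurableU; apply: measurableI => //.
exact: measurable_translate.
Qed.

Definition cf_act (h : G) x : X := ((h * x.1)%g, x.2).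

Lemma cut_act n h x : cut n (cf_act h x) = cf_act h (cut n x).
Proof. by rewrite /cut /cf_act /=; case: ifP => //=; rewrite mulgA. Qed.

Lemma reduce_act n h x : reduce n (cf_act h x) = cf_act h (reduce n x).
Proof. by elim: n => //= n ->; rewrite cut_act. Qed.

Lemma cf_act1 x : cf_act 1%g x = x.
Proof. by case: x => g w; rewrite /cf_act mul1g. Qed.

Lemma cf_actM g h x : cf_act (g * h)%g x = cf_act g (cf_act h x).
Proof. by rewrite /cf_act /= mulgA. Qed.

Lemma measurable_act h E : measurable E -> measurable (cf_act h @^-1` E).
Proof.
move=> mE; split=> [g|n x xn]; first exact: (measurable_slice (h * g)%g mE).
by rewrite /preimage /= -cut_act; exact: cutP.
Qed.

(** The products of at most one copy of each of [s K, ..., s (K + d - 1)], in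
this order: the positions at which the first column of stage [K] has been stacked
by stage [K + d]. *)
Fixpoint spacer_words (K d : nat) : {fset G} :=
  if d is d'.+1 then
    (spacer_words K d' `|` [fset (g * s (K + d'))%g | g in spacer_words K d'])%fset
  else [fset 1%g]%fset.

Lemma card_spacer_words K d : (#|` spacer_words K d| <= 2 ^ d)%N.
Proof.
elim: d => [|d IHd] /=; first by rewrite cardfs1.
rewrite (leq_trans (leq_card_fsetU _ _).1)//.
rewrite expnS mul2n -addnn leq_add//.
by apply: leq_trans IHd; exact: leq_imfset_card.
Qed.

Lemma reduce_spacer_words K d x : (reduce (K + d) x).1 \in spacer_words K d ->
  (reduce (K + d.+1) x).1 \in spacer_words K d.+1.
Proof.
rewrite addnS /= /cut; case: ifP => _ h; rewrite inE ?h //.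
by apply/orP; right; exact: in_imfset.
Qed.

Lemma reduce_spacer_words_le K d e x : (d <= e)%N ->
  (reduce (K + d) x).1 \in spacer_words K d ->
  (reduce (K + e) x).1 \in spacer_words K e.
Proof.
elim: e => [|e IHe]; first by rewrite leqn0 => /eqP ->.
rewrite leq_eqVlt => /predU1P[-> //|de /IHe h].
exact/reduce_spacer_words/h.
Qed.

(** The saturation of the slice {1} x [0, 2^-K[.  A reduced point at position [g]
comes from that slice when [g] is one of the positions at which it was stacked. *)
Definition base (K : nat) : set X := [set x | dyadic 0 x.2 /\
  exists d, (reduce (K + d) x).1 \in spacer_words K d].

Lemma baseP K e x : base K x ->
  exists2 d, (e <= d)%N & (reduce (K + d) x).1 \in spacer_words K d.
Proof.
case=> _ [d xd]; exists (maxn e d); first exact: leq_maxl.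
exact: reduce_spacer_words_le (leq_maxr _ _) xd.
Qed.

Lemma measurable_base K : measurable (base K).
Proof.
split=> [g|n x xn].
  have -> : slice (base K) g = dyadic 0 `&` \bigcup_d
      slice (reduce (K + d) @^-1` [set x | x.1 \in spacer_words K d]) g.
    by apply/seteqP; split => w; [case=> ? [d ?]|case=> ? [d _ ?]];
      split => //; exists d.
  apply: measurableI; first exact: measurable_dyadic.
  apply: bigcupT_measurable => d; apply: measurable_slice_reduce => h.
  rewrite /slice /=; case: (h \in _).
    by rewrite (_ : [set _ | _] = setT) //; apply/seteqP; split.
  by rewrite (_ : [set _ | _] = set0) //; apply/seteqP; split.
have x0 : dyadic 0 x.2 by exact: dyadic_le xn.
have cx0 : dyadic 0 (cut n x).2 by exact: dyadic_le (cut_dyadic xn).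
split=> bx; split=> //; have [d nd h] := baseP n.+1 bx; exists d;
  by move: h; rewrite reduce_cut // (leq_trans nd) // leq_addl.
Qed.

(** The translates of [base K] cover the columns; there are countably many of
them, and their mass is small when [K] is large. *)
Lemma cf_baseE K g w : dyadic 0 w -> exists h, base K (cf_act h (g, w)).
Proof.
move=> w0; exists (reduce K (g, w)).1^-1%g; split=> //; exists 0%N.
by rewrite addn0 reduce_act /= mulVg inE.
Qed.

End Space.

(** * The invariant measure *)

Lemma lee_sum_uniq_sub (R : realType) (I : eqType) (t r : seq I) (F : I -> \bar R) :
  uniq t -> uniq r -> {subset t <= r} -> (forall i, 0 <= F i)%E ->
  (\sum_(i <- t) F i <= \sum_(i <- r) F i)%E.
Proof.
move=> ut ur tr F0.
have pe : perm_eq t [seq i <- r | i \in t].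
  apply: uniq_perm => //; first exact: filter_uniq.
  by move=> i; rewrite mem_filter; case: (boolP (i \in t)) => // /tr ->.
rewrite (perm_big _ pe) big_filter [leRHS](bigID (fun i => i \in t)) /=.
by rewrite leeDl // sume_ge0.
Qed.

(** The windows exhaust the group while stage [n] copies the window [n] and its
disjoint translate by the spacer into the window [n + 1].  The absorption
condition says that, after any fixed translation, the copies still fit in the
next window; this is what makes the measure invariant. *)
Record cf_data (G : groupType) := CFData {
  spacer : nat -> G;
  window : nat -> {fset G};
  window_one : 1%g \in window 0;
  window_spacer : forall n g h, g \in window n -> h \in window n ->
    g <> (h * spacer n)%g;
  window_sub : forall n g, g \in window n ->
    g \in window n.+1 /\ (g * spacer n)%g \in window n.+1;
  window_absorb : forall h, exists N, forall n, (N <= n)%N ->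
    forall g, g \in window n ->
      (h * g)%g \in window n.+1 /\ (h * g * spacer n)%g \in window n.+1 }.

Section Measure.
Context (R : realType) {G : groupType} (D : cf_data G).

Local Notation X := (cf_space R (spacer D)).
Local Notation lambda := (@lebesgue_measure R).
Implicit Types (x : X) (E : set X) (g h : G).

Definition slice_measure g (n : nat) E : \bar R :=
  lambda (slice E g `&` dyadic n).

Let slice_measure0 g n : slice_measure g n set0 = 0%E.
Proof. by rewrite /slice_measure set0I measure0. Qed.

Let slice_measure_ge0 g n E : (0 <= slice_measure g n E)%E.
Proof. exact: measure_ge0. Qed.

Let slice_measure_sigma_additive g n :
  semi_sigma_additive (slice_measure g n).
Proof.
move=> F mF tF mUF; rewrite /slice_measure.
have -> : slice (\bigcup_i F i) g `&` dyadic n =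
    \bigcup_i (slice (F i) g `&` dyadic n) by rewrite -setI_bigcupl.
apply: measure_semi_sigma_additive.
- move=> i; apply: measurableI; last exact: measurable_dyadic.
  exact: measurable_slice.
- apply/trivIsetP => i j _ _ ij; apply/seteqP; split=> // w [[Fi _] [Fj _]].
  move/trivIsetP : tF => /(_ i j Logic.I Logic.I ij) Fij.
  by have : (F i `&` F j) (g, w) by []; rewrite Fij.
- apply: bigcupT_measurable => i; apply: measurableI; last exact: measurable_dyadic.
  exact: measurable_slice.
Qed.

HB.instance Definition _ g n := isMeasure.Build _ _ _ (slice_measure g n)
  (slice_measure0 g n) (slice_measure_ge0 g n)
  (@slice_measure_sigma_additive g n).

(** The positions of stage [n] that are not copies of positions of stage [n - 1]:
their columns are new mass. *)
Definition layer (n : nat) : seq G :=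
  if n is m.+1 then
    [seq g <- window D m.+1 | (g \notin window D m) &&
       (g \notin [seq (h * spacer D m)%g | h <- window D m])]
  else window D 0.

(** The total mass of the new columns of all stages.  By [window_measure_sum] it is
the increasing limit of the masses of the stages, which are easier to handle. *)
Definition cf_measure : set X -> \bar R :=
  mseries (fun n => msum (fun i => slice_measure (nth 1%g (layer n) i) n)
                         (size (layer n))) 0.

HB.instance Definition _ := Measure.on cf_measure.

Definition window_measure n E : \bar R :=
  (\sum_(g <- window D n) slice_measure g n E)%E.

(** Saturation turns the right half of the interval of stage [n] into the left
half at the position translated by the spacer. *)
Lemma slice_measureS g n E : measurable E ->
  slice_measure g n E = (slice_measure g n.+1 E +
                         slice_measure (g * spacer D n)%g n.+1 E)%E.
Proof.
move=> mE; have mS h : measurable (slice E h `&` dyadic n.+1).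
  by apply: measurableI; [exact: measurable_slice|exact: measurable_dyadic].
rewrite /slice_measure -[X in (_ + X)%E](lebesgue_translate (2 ^- n.+1)) //.
have hS := dyadic_lengthS (R := R) n.
have h0 := dyadic_length_gt0 (R := R) n.+1.
rewrite -measureU //; last 3 first.
- exact: mS.
- exact: measurable_translate.
- apply/seteqP; split=> // w [[_ /dyadicP ?] [_ /dyadicP ?]]; lra.
congr (lambda _); apply/seteqP; split => [w [Ew wn]|w].
  have := cutP mE (x := (g, w)) wn; rewrite /cut /=.
  move/dyadicP: (wn); case: (ltP w (2 ^- n.+1)) => w1 w2 Ec;
    [left|right]; split => //.
  - by apply/dyadicP; lra.
  - exact/Ec.
  - by apply/dyadicP; lra.
move=> [[Ew /dyadicS] //|[Ew /dyadicP w1]].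
have wn : dyadic n w by apply/dyadicP; lra.
split=> //; apply/(cutP mE (x := (g, w)) wn); rewrite /cut /=.
by case: ltP => // w2; lra.
Qed.

Lemma window_measureS n E : measurable E ->
  window_measure n.+1 E =
    (window_measure n E + \sum_(g <- layer n.+1) slice_measure g n.+1 E)%E.
Proof.
move=> mE; rewrite /window_measure.
under [X in (_ = X + _)%E]eq_bigr do rewrite slice_measureS //.
rewrite big_split /= -[X in (_ + X + _)%E]
  (big_map (fun g => g * spacer D n)%g xpredT (fun g => slice_measure g n.+1 E)).
rewrite -!big_cat /=; apply: perm_big; apply: uniq_perm => //.
- exact: fset_uniq.
- rewrite !cat_uniq fset_uniq filter_uniq ?fset_uniq //= andbT.
  rewrite map_inj_uniq ?fset_uniq /= ?andbT; last exact: mulIg.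
  apply/andP; split; apply/hasPn => g; rewrite ?mem_filter ?mem_cat.
    by move=> /mapP[h hn ->]; apply/negP => hs; exact: (window_spacer hs hn).
  by move=> /andP[/andP[/negPf -> /negPf ->]].
- move=> g; rewrite !mem_cat mem_filter.
  have [gn|gn] := boolP (g \in window D n) => /=; first by rewrite (window_sub gn).1.
  have [/mapP[h hn ->]|] :=
    boolP (g \in [seq (h * spacer D n)%g | h <- window D n]) => //=.
  by rewrite (window_sub hn).2.
Qed.

Lemma cf_measureE E :
  cf_measure E = (\sum_(0 <= n <oo) \sum_(g <- layer n) slice_measure g n E)%E.
Proof.
apply: eq_eseriesr => n _.
by rewrite /msum (big_nth 1%g) big_mkord.
Qed.

Lemma window_measure_sum n E : measurable E -> window_measure n E =
  (\sum_(0 <= k < n.+1) \sum_(g <- layer k) slice_measure g k E)%E.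
Proof.
move=> mE; elim: n => [|n IHn]; first by rewrite big_nat1.
by rewrite window_measureS // IHn [RHS]big_nat_recr.
Qed.

Lemma window_measure_le n E : measurable E ->
  (window_measure n E <= cf_measure E)%E.
Proof.
move=> mE; rewrite window_measure_sum // cf_measureE.
by apply: nneseries_lim_ge => k _ _; exact: sume_ge0.
Qed.

Lemma cf_measure_le N c E : measurable E ->
  (forall n, (N <= n)%N -> window_measure n E <= c)%E -> (cf_measure E <= c)%E.
Proof.
move=> mE Ec; rewrite cf_measureE; apply: lime_le.
  by apply: is_cvg_nneseries => k _ _; exact: sume_ge0.
near=> n; have := Ec n.-1; rewrite window_measure_sum // prednK; last first.
  by near: n; exists 1%N.
apply; have : (N.+1 <= n)%N by near: n; exists N.+1.
lia.
Unshelve. all: by end_near. Qed.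

(** Absorption puts the stage [n] inside the translate of the stage [n + 1], so a
translation cannot decrease the measure; neither can its inverse. *)
Lemma cf_measure_act_ge h E : measurable E ->
  (cf_measure E <= cf_measure (cf_act h @^-1` E))%E.
Proof.
move=> mE; have [N absorb] := window_absorb D h^-1%g.
apply: (@cf_measure_le N) => // n /absorb hn.
apply: le_trans (window_measure_le n.+1 (measurable_act h mE)).
rewrite /window_measure.
under eq_bigr do rewrite slice_measureS //.
rewrite big_split /=.
rewrite [X in (_ <= X)%E](_ : _ =
  \sum_(g <- window D n.+1) slice_measure (h * g)%g n.+1 E)%E //.
rewrite -[X in (_ + X)%E](big_map (fun g => g * spacer D n)%g xpredT
  (fun g => slice_measure g n.+1 E)) -big_cat /=.
rewrite -[X in (_ <= X)%E](big_map (fun g => h * g)%g xpredT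
  (fun g => slice_measure g n.+1 E)).
apply: lee_sum_uniq_sub => //.
- rewrite cat_uniq fset_uniq map_inj_uniq ?fset_uniq ?andbT; last exact: mulIg.
  apply/hasPn => g /mapP[g' g'n ->].
  by apply/negP => /(window_spacer)/(_ g'n); apply.
- by rewrite map_inj_uniq ?fset_uniq //; exact: mulgI.
- move=> g; rewrite mem_cat => /orP[gn|/mapP[g' gn ->]].
    by rewrite -(mulVKg h g) map_f // (hn _ gn).1.
  by rewrite -(mulVKg h (g' * _)%g) map_f // mulgA (hn _ gn).2.
Qed.

Lemma cf_measure_act h E : measurable E ->
  cf_measure (cf_act h @^-1` E) = cf_measure E.
Proof.
move=> mE; apply/le_anti/andP; split; last exact: cf_measure_act_ge.
have := cf_measure_act_ge h^-1%g (measurable_act h mE).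
congr (_ <= cf_measure _)%E; apply/funext => x.
by rewrite /preimage /= -cf_actM mulgV cf_act1.
Qed.

Lemma slice_measure_le g n E : measurable E ->
  (slice_measure g n E <= (2 ^- n)%:E)%E.
Proof.
move=> mE; rewrite -lebesgue_dyadic; apply: le_measure; rewrite ?inE //.
- by apply: measurableI; [exact: measurable_slice|exact: measurable_dyadic].
- exact: measurable_dyadic.
Qed.

Lemma cf_measure_eq0 E : measurable E ->
  (forall g n, slice_measure g n E = 0%E) -> cf_measure E = 0%E.
Proof.
move=> mE E0; apply/eqP; rewrite eq_le measure_ge0 andbT.
by apply: (@cf_measure_le 0) => // n _; rewrite /window_measure big1.
Qed.

Lemma window_le g m n : (m <= n)%N -> g \in window D m -> g \in window D n.
Proof.
elim: n => [|n IHn]; first by rewrite leqn0 => /eqP ->.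
by rewrite leq_eqVlt => /predU1P[-> //|mn /(IHn mn)/window_sub[]].
Qed.

Lemma spacer_words_window K d :
  {subset spacer_words (spacer D) K d <= window D (K + d)}.
Proof.
elim: d => [|d IHd] g /=.
  by rewrite inE => /eqP ->; exact: window_le (window_one D).
rewrite addnS inE => /orP[/IHd/window_sub[]//|].
by case/imfsetP => h /= /IHd/window_sub[_ ?] ->.
Qed.

Lemma reduce_window n m x : (n <= m)%N -> (reduce n x).1 \in window D n ->
  (reduce m x).1 \in window D m.
Proof.
move=> nm xn; elim: m nm => [|m IHm]; first by rewrite leqn0 => /eqP <-.
rewrite leq_eqVlt => /predU1P[<- //|/IHm /window_sub /= [h1 h2]].
by rewrite /cut; case: ifP.
Qed.

(** A position of the window of an early stage that becomes a word in the spacers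
at a later stage was one already: windows and their translates by spacers are
disjoint, so the last letter can be read off and cancelled. *)
Lemma spacer_words_reduce K e d x :
  (reduce (K + e) x).1 \in window D (K + e) ->
  (reduce (K + (e + d)) x).1 \in spacer_words (spacer D) K (e + d) ->
  (reduce (K + e) x).1 \in spacer_words (spacer D) K e.
Proof.
move=> we; elim: d => [|d IHd]; first by rewrite addn0.
rewrite !addnS /= => h; apply: IHd; move: h.
have := reduce_window (leq_addr d (K + e)) we; rewrite -addnA.
set y := reduce _ _ => wy; rewrite /cut inE.
have W := @spacer_words_window K (e + d).
case: ifP => _ /= /orP[//|/imfsetP[h /= hW]].
- by move=> yE; move: wy; rewrite yE => /window_spacer/(_ (W _ hW)).
- by move=> /W /window_spacer/(_ wy).
- by move=> /mulIg ->.
Qed.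

(** At stage [n] the set [base K] meets only the columns over the at most 2^(n-K)
words in the spacers [K, ..., n - 1], each of width 2^-n. *)
Lemma cf_measure_base_le K : (cf_measure (base K) <= (2 ^- K)%:E)%E.
Proof.
apply: (@cf_measure_le K) => [|n Kn]; first exact: measurable_base.
pose SW := spacer_words (spacer D) K (n - K).
have SWn : {subset SW <= window D n}.
  by move=> g /spacer_words_window; rewrite subnKC.
apply: (@le_trans _ _ (\sum_(g <- window D n | g \in SW) (2 ^- n)%:E)%E).
  rewrite [leRHS]big_mkcond /= /window_measure big_seq [leRHS]big_seq.
  apply: lee_sum => g gn; case: ifPn => gS.
    by apply: slice_measure_le; exact: measurable_base.
  rewrite /slice_measure (_ : _ `&` _ = set0) ?measure0 //.
  apply/seteqP; split => // w [/= bw wn].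
  have [d nd hd] := baseP (n - K) bw.
  move/negP: gS; apply; rewrite -[g]/(g, w).1 -(@reduce_id R G (spacer D) n (g, w)) //.
  have := @spacer_words_reduce K (n - K) (d - (n - K)) (g, w).
  rewrite !subnKC // reduce_id //; exact.
rewrite -big_filter; apply: (@le_trans _ _ (\sum_(g <- SW) (2 ^- n)%:E)%E).
  apply: lee_sum_uniq_sub => //; rewrite ?filter_uniq ?fset_uniq //.
  by move=> g; rewrite mem_filter => /andP[].
rewrite sumEFin lee_fin big_const_seq count_predT iter_addr_0 -[leLHS]mulr_natl.
have -> : 2 ^- K = 2 ^+ (n - K) * 2 ^- n :> R.
  rewrite -{2}(subnKC Kn) exprD; field; by rewrite !expf_neq0.
rewrite ler_pM2r ?dyadic_length_gt0 // -natrX ler_nat.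
exact: card_spacer_words.
Qed.

End Measure.

(** * A zero-one law for dyadic periods *)

Lemma exists_dyadic_lt (R : realType) (e : R) : 0 < e -> exists n, 2 ^- n < e.
Proof.
move=> e0; have [N _ /(_ N (leqnn N))] := near_infty_natSinv_expn_lt (PosNum e0).
by rewrite /= div1r => ?; exists N.
Qed.

Section ZeroOne.
Context {R : realType}.
Local Notation lambda := (@lebesgue_measure R).

Definition dyadic_periodic (S : set R) :=
  forall n w, dyadic n.+1 w -> S w <-> S (w + 2 ^- n.+1).

Definition dyadic_mass (S : set R) : R := fine (lambda (S `&` dyadic 0)).

Lemma dyadic_fin_num (S A : set R) : measurable S -> measurable A ->
  lambda (A `&` (S `&` dyadic 0)) \is a fin_num.
Proof.
move=> mS mA; rewrite ge0_fin_numE ?measure_ge0 //.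
apply: (@le_lt_trans _ _ (lambda (dyadic 0))); last by rewrite lebesgue_dyadic ltry.
apply: le_measure; rewrite ?inE; last by move=> w [_ []].
  by apply: measurableI => //; apply: measurableI => //; exact: measurable_dyadic.
exact: measurable_dyadic.
Qed.

Lemma dyadic_periodicM (S : set R) n w k : dyadic_periodic S -> dyadic n w ->
  (k < 2 ^ n)%N -> S w <-> S (w + k%:R * 2 ^- n).
Proof.
move=> pS; elim: n w k => [|n IHn] w k wn.
  by rewrite expn0 ltnS leqn0 => /eqP ->; rewrite mul0r addr0.
move=> kn; have kE := odd_double_half k.
have hS := dyadic_lengthS (R := R) n.
have wn' : dyadic n (w + (odd k)%:R * 2 ^- n.+1).
  move/dyadicP: wn => wn; apply/dyadicP.
  by case: (odd k); rewrite ?mul0r ?mul1r; lra.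
have kn' : (k./2 < 2 ^ n)%N by move: kn; rewrite expnS; lia.
have -> : w + k%:R * 2 ^- n.+1 =
    (w + (odd k)%:R * 2 ^- n.+1) + k./2%:R * 2 ^- n.
  by rewrite -[in LHS]kE hS -mul2n natrD natrM; ring.
rewrite -IHn //; case: (odd k); rewrite ?mul0r ?addr0 // mul1r; exact: pS.
Qed.

Lemma lebesgue_dyadic_piece (S : set R) n k : measurable S ->
  dyadic_periodic S -> (k < 2 ^ n)%N ->
  lambda (S `&` `[k%:R * 2 ^- n, k.+1%:R * 2 ^- n[) = lambda (S `&` dyadic n).
Proof.
move=> mS pS kn.
have mI : measurable (S `&` dyadic n).
  by apply: measurableI => //; exact: measurable_dyadic.
rewrite -(lebesgue_translate (k%:R * 2 ^- n) mI); congr (lambda _).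
have wE (w : R) : `[k%:R * 2 ^- n, k.+1%:R * 2 ^- n[%classic w <->
    dyadic n (w - k%:R * 2 ^- n).
  rewrite /= in_itv /= -(natr1 k) mulrDl mul1r.
  by split=> [?|/dyadicP ?]; [apply/dyadicP; lra|lra].
apply/seteqP; split=> w [Sw wn].
  have wn' := (wE w).1 wn; split=> //.
  by have := dyadic_periodicM pS wn' kn; rewrite subrK => h; apply/h.
split; last exact/wE.
by have := dyadic_periodicM pS wn kn; rewrite subrK => h; apply/h.
Qed.

Lemma lebesgue_dyadic_initial (S : set R) n k : measurable S ->
  dyadic_periodic S -> (k <= 2 ^ n)%N ->
  lambda (S `&` `[0, k%:R * 2 ^- n[) = (k%:R * fine (lambda (S `&` dyadic n)))%:E.
Proof.
move=> mS pS; elim: k => [|k IHk] kn.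
  rewrite !mul0r set_itvE ?setI0 ?measure0 //; exact: ltxx.
have k0 : 0 <= k%:R * 2 ^- n :> R by rewrite mulr_ge0.
rewrite (_ : `[0, k.+1%:R * 2 ^- n[%classic =
   `[0, k%:R * 2 ^- n[ `|` `[k%:R * 2 ^- n, k.+1%:R * 2 ^- n[); last first.
  apply: itv_bndbnd_setU; rewrite bnd_simp //.
  by rewrite ler_pM2r ?dyadic_length_gt0 // ler_nat.
rewrite setIUr measureU; last 3 first.
- by apply: measurableI.
- by apply: measurableI.
- by apply/seteqP; split => // w [[_ +] [_ +]]; rewrite /= !in_itv /=; lra.
rewrite -[in RHS](natr1 k) mulrDl mul1r EFinD.
congr (_ + _)%E; first exact: IHk (ltnW kn).
rewrite fineK; first exact: lebesgue_dyadic_piece.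
have := @dyadic_fin_num S (dyadic n) mS (measurable_dyadic n).
rewrite setIA (setIC _ S) -setIA (_ : _ `&` dyadic 0 = dyadic n) //.
by apply/setIidPl; exact: dyadic_le.
Qed.

Lemma dyadic_mass_level (S : set R) n : measurable S -> dyadic_periodic S ->
  fine (lambda (S `&` dyadic n)) = dyadic_mass S * 2 ^- n.
Proof.
move=> mS pS; rewrite /dyadic_mass.
have := @lebesgue_dyadic_initial S n (2 ^ n) mS pS (leqnn _).
rewrite natrX divff ?expf_neq0 // => h.
have -> : dyadic 0 = `[0, 1[%classic :> set R by rewrite /dyadic expr0 invr1.
by rewrite h /= mulrAC divff ?expf_neq0 // mul1r.
Qed.

(** Sandwich [x] between consecutive multiples of 2^-n, where the distribution
function is known by periodicity. *)
Lemma dyadic_cdf (S : set R) x : measurable S -> dyadic_periodic S ->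
  0 <= x < 1 ->
  lambda (`]-oo, x] `&` (S `&` dyadic 0)) = (dyadic_mass S * x)%:E.
Proof.
move=> mS pS /andP[x0 x1].
have mx : measurable `]-oo, x] by [].
have fx := dyadic_fin_num mS mx; rewrite -(fineK fx); congr (_%:E).
set H := fine _.
have b0 : 0 <= dyadic_mass S by rewrite fine_ge0.
have mD0 := @measurable_dyadic R 0.
have bounds n : `|H - dyadic_mass S * x| <= dyadic_mass S * 2 ^- n.
  pose k := Num.truncn (x * 2 ^+ n).
  have p0 : 0 < 2 ^+ n :> R by rewrite exprn_gt0.
  have /andP[k1 k2] : k%:R <= x * 2 ^+ n < k.+1%:R.
    by apply: truncn_itv; rewrite mulr_ge0 // ltW.
  have kn : (k.+1 <= 2 ^ n)%N.
    rewrite -(ltr_nat R) natrX; apply: le_lt_trans k1 _.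
    by rewrite gtr_pMl.
  have e1 : k%:R * 2 ^- n <= x by rewrite ler_pdivrMr.
  have e2 : x < k.+1%:R * 2 ^- n by rewrite ltr_pdivlMr.
  have := @lebesgue_dyadic_initial S n k mS pS (ltnW kn).
  have := @lebesgue_dyadic_initial S n k.+1 mS pS kn.
  rewrite dyadic_mass_level // => hu hl.
  pose lo : set R := `[0, k%:R * 2 ^- n[%classic.
  pose up : set R := `[0, k.+1%:R * 2 ^- n[%classic.
  have mlo : measurable lo by exact: measurable_itv.
  have mup : measurable up by exact: measurable_itv.
  have : (lambda (S `&` lo) <=
          lambda (`]-oo, x] `&` (S `&` dyadic 0)))%E.
    apply: le_measure; rewrite ?inE; first exact: measurableI.
      by apply: measurableI => //; exact: measurableI.
    move=> w [Sw]; rewrite /lo /= !in_itv /= => w1; split; last split => //.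
      by lra.
    by apply/dyadicP; rewrite expr0 invr1; lra.
  rewrite hl -(fineK fx) lee_fin -/H => l1.
  have : (lambda (`]-oo, x] `&` (S `&` dyadic 0)) <=
          lambda (S `&` up))%E.
    apply: le_measure; rewrite ?inE; last first.
    - move=> w [+ [Sw /dyadicP w1]]; rewrite /up /= !in_itv /= => w2.
      by split=> //; lra.
    - exact: measurableI.
    - by apply: measurableI => //; exact: measurableI.
  rewrite hu -(fineK fx) lee_fin -/H => l2.
  move: e2 l2; rewrite -(natr1 k) !mulrDl !mul1r => e2 l2.
  have m1 := ler_wpM2l b0 e1; have m2 := ler_wpM2l b0 (ltW e2).
  rewrite mulrDr in m2.
  rewrite mulrCA in l1; rewrite mulrCA in l2.
  by rewrite ler_norml; lra.
apply/eqP; rewrite -subr_eq0 -normr_le0 leNgt; apply/negP => d0.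
have [n nd] := exists_dyadic_lt (divr_gt0 d0 (ltr_pwDl ltr01 b0)).
have := bounds n; rewrite leNgt => /negP; apply.
rewrite ltr_pdivlMr in nd; last by rewrite ltr_pwDl.
apply: le_lt_trans nd; rewrite mulrC ler_wpM2l ?ltW ?dyadic_length_gt0 //.
by lra.
Qed.

Lemma dyadic_mass_itv (S : set R) (a b : R) : measurable S ->
  dyadic_periodic S ->
  lambda (`]a, b] `&` (S `&` dyadic 0)) =
  ((dyadic_mass S)%:E * lambda (`]a, b] `&` dyadic 0))%E.
Proof.
move=> mS pS.
have mD0 := @measurable_dyadic R 0.
have pT : dyadic_periodic [set: R] by [].
have mT : dyadic_mass [set: R] = 1.
  by rewrite /dyadic_mass setTI lebesgue_dyadic /= expr0 invr1.
have cdf x : lambda (`]-oo, x] `&` (S `&` dyadic 0)) =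
    ((dyadic_mass S)%:E * lambda (`]-oo, x] `&` ([set: R] `&` dyadic 0)))%E.
  have [x0|x0] := ltP x 0.
    have empty (U : set R) : `]-oo, x] `&` (U `&` dyadic 0) = set0.
      apply/seteqP; split=> // w [+ [_ /dyadicP]]; rewrite /= in_itv /=; lra.
    by rewrite !empty measure0 mule0.
  have [x1|x1] := ltP x 1.
    by rewrite !dyadic_cdf ?x0 ?x1 // mT mul1r.
  have full (U : set R) : `]-oo, x] `&` (U `&` dyadic 0) = U `&` dyadic 0.
    apply/setIidPr => w [_ /dyadicP]; rewrite expr0 invr1 /= in_itv /=; lra.
  rewrite !full setTI lebesgue_dyadic expr0 invr1 mule1 /dyadic_mass fineK //.
  by have := @dyadic_fin_num S setT mS measurableT; rewrite setTI.
have [ab|ab] := leP a b; last first.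
  have -> : `]a, b]%classic = set0.
    apply/seteqP; split=> // w; rewrite /= in_itv /=; lra.
  by rewrite !set0I measure0 mule0.
have diff (U : set R) : measurable U ->
   lambda (`]a, b] `&` (U `&` dyadic 0)) =
   (lambda (`]-oo, b] `&` (U `&` dyadic 0)) -
    lambda (`]-oo, a] `&` (U `&` dyadic 0)))%E.
  move=> mU; have mUD : measurable (U `&` dyadic 0) by exact: measurableI.
  rewrite (_ : `]-oo, b]%classic = `]-oo, a] `|` `]a, b]); last first.
    by apply: itv_bndbnd_setU; rewrite bnd_simp.
  rewrite setIUl measureU //; last 3 first.
  - exact: measurableI.
  - exact: measurableI.
  - by apply/seteqP; split=> // w [[+ _] [+ _]]; rewrite /= !in_itv /=; lra.
  by rewrite addeAC subee ?add0e //; exact: dyadic_fin_num.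
rewrite diff // !cdf -muleBr //; last first.
  by rewrite fin_num_adde_defl // fin_numN; exact: dyadic_fin_num.
by have := diff setT measurableT; rewrite !setTI => ->.
Qed.

(** If the mass [m] of [S] in [0, 1[ is positive, then A |-> |A n S n [0, 1[| / m +
|A - [0, 1[| agrees with Lebesgue measure on half-open intervals, hence
everywhere; and it vanishes on the part of [0, 1[ outside [S]. *)
Lemma dyadic_zero_one (S : set R) : measurable S -> dyadic_periodic S ->
  lambda (S `&` dyadic 0) = 0%E \/ lambda (~` S `&` dyadic 0) = 0%E.
Proof.
move=> mS pS; have mD0 := @measurable_dyadic R 0.
have b0 : 0 <= dyadic_mass S by rewrite fine_ge0.
have fS : lambda (S `&` dyadic 0) \is a fin_num.
  by have := @dyadic_fin_num S setT mS measurableT; rewrite setTI.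
have [bE|bN0] := eqVneq (dyadic_mass S) 0.
  by left; rewrite -(fineK fS) -/(dyadic_mass S) bE.
right; have vb0 : 0 <= (dyadic_mass S)^-1 by rewrite invr_ge0.
have mSD : measurable (S `&` dyadic 0) by exact: measurableI.
have mDC : measurable (~` dyadic 0 : set R) by exact: measurableC.
pose nu := measure_add (mscale (NngNum vb0) (mrestr lambda mSD)) (mrestr lambda mDC).
have nuD A : nu A = ((dyadic_mass S)^-1%:E * lambda (A `&` (S `&` dyadic 0)) +
    lambda (A `&` ~` dyadic 0))%E by rewrite [LHS]measure_addE.
have nuE A : measurable A -> lambda A = nu A.
  apply: lebesgue_measure_unique => _ [[x y] _ <-].
  apply: etrans _ (esym (nuD _)); rewrite dyadic_mass_itv //.
  rewrite muleA -EFinM mulVf // mul1e -measureU //; last 3 first.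
  - exact: measurableI.
  - exact: measurableI.
  - by apply/seteqP; split => // w [[_ ?] [_ ?]].
  by rewrite -setIUr setUv setIT.
have mCS : measurable (~` S `&` dyadic 0).
  by apply: measurableI => //; exact: measurableC.
apply: etrans (nuE _ mCS) _; apply: etrans (nuD _) _.
rewrite (_ : _ `&` (S `&` _) = set0); last first.
  by apply/seteqP; split => // w [[? _] [? _]].
rewrite (_ : _ `&` ~` _ = set0); last first.
  by apply/seteqP; split => // w [[_ ?] ?].
by rewrite !measure0 mule0 adde0.
Qed.

End ZeroOne.

(** * Ergodicity and non-atomicity *)

Section Action.
Context (R : realType) {G : groupType} (D : cf_data G).

Local Notation X := (cf_space R (spacer D)).
Local Notation lambda := (@lebesgue_measure R).
Implicit Types (x : X) (E : set X) (g h : G).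

(** An enumeration of the group, which is the union of the finite windows. *)
Definition window_enum (k : nat) : G :=
  if CodeSeq.decode k is [:: n; i] then nth 1%g (window D n) i else 1%g.

Lemma window_enumP g : exists k, window_enum k = g.
Proof.
have [N hN] := window_absorb D g.
have gN : g \in window D N.+1.
  rewrite -(mulg1 g); apply: (hN N (leqnn N) _ _).1.
  exact: window_le (window_one D).
exists (CodeSeq.code [:: N.+1; index g (window D N.+1)]).
by rewrite /window_enum CodeSeq.codeK nth_index.
Qed.

(** The slices over the real numbers outside [0, 1[ carry no mass. *)
Definition outside : set X := [set x | ~ dyadic 0 x.2].

Lemma measurable_outside : measurable outside.
Proof.
split=> [g|n x xn]; first by apply: measurableC; exact: measurable_dyadic.
have x0 : dyadic 0 x.2 by exact: dyadic_le xn.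
have cx0 : dyadic 0 (cut (s := spacer D) n x).2.
  by exact: dyadic_le (cut_dyadic xn).
by split.
Qed.

Lemma cf_measure_outside : cf_measure outside = 0%E.
Proof.
apply: cf_measure_eq0 => [|g n]; first exact: measurable_outside.
rewrite /slice_measure (_ : _ `&` _ = set0) ?measure0 //.
by apply/seteqP; split=> // w [wN /(dyadic_le (leq0n n))].
Qed.

Definition piece K (k : nat) : set X := cf_act (window_enum k) @^-1` base K.

Lemma measurable_piece K k : measurable (piece K k).
Proof. by apply: measurable_act; exact: measurable_base. Qed.

Lemma cf_measure_piece K k : (cf_measure (piece K k) <= (2 ^- K)%:E)%E.
Proof.
rewrite cf_measure_act; first exact: cf_measure_base_le.
exact: measurable_base.
Qed.

Lemma piece_cover K x : outside x \/ exists k, piece K k x.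
Proof.
have [x0|] := pselect (dyadic 0 x.2); last by left.
right; have [h] := cf_baseE (spacer D) K x.1 x0.
have [k <-] := window_enumP h => bx; exists k.
by case: x {x0} bx.
Qed.

Lemma cf_sigma_finite : sigma_finite setT (@cf_measure R G D).
Proof.
exists (fun k => outside `|` piece 0 k).
  apply/esym/seteqP; split=> // x _.
  by have [xo|[k xk]] := piece_cover 0 x;
    [exists 0%N => //; left|exists k => //; right].
move=> k; split.
  by apply: measurableU; [exact: measurable_outside|exact: measurable_piece].
apply: (@le_lt_trans _ _ (cf_measure outside + cf_measure (piece 0 k))%E).
  by apply: measureU2; [exact: measurable_outside|exact: measurable_piece].
rewrite cf_measure_outside add0e.
by apply: le_lt_trans (cf_measure_piece 0 k) _; rewrite ltry.
Qed.

HB.instance Definition _ :=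
  @Measure_isSigmaFinite.Build _ _ _ (@cf_measure R G D) cf_sigma_finite.

Lemma cf_measure_piece_pos K E : measurable E -> (0 < cf_measure E)%E ->
  exists k, (0 < cf_measure (E `&` piece K k))%E.
Proof.
move=> mE; apply: contraPP => /forallNP nE.
have E0 k : cf_measure (E `&` piece K k) = 0%E.
  by apply/eqP; have /negP := nE k; rewrite lt0e measure_ge0 andbT negbK.
suff -> : cf_measure E = 0%E by rewrite ltxx.
apply/negligibleP => //.
apply: (@negligibleS _ _ _ _ (outside `|` \bigcup_k (E `&` piece K k))).
  move=> x Ex; have [xo|[k xk]] := piece_cover K x; [by left|by right; exists k].
apply: negligibleU.
  by apply/negligibleP; [exact: measurable_outside|exact: cf_measure_outside].
apply: negligible_bigcup => k; apply/negligibleP; last exact: E0.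
by apply: measurableI => //; exact: measurable_piece.
Qed.

(** For every [K], an atom has the same measure as its intersection with one of
the pieces of mass at most 2^-K. *)
Lemma cf_non_atomic : non_atomic (@cf_measure R G D).
Proof.
case=> E [mE E0 atomE].
have Esmall K : (cf_measure E <= (2 ^- K)%:E)%E.
  have [k kE] := cf_measure_piece_pos K mE E0.
  have mk : measurable (E `&` piece K k).
    by apply: measurableI => //; exact: measurable_piece.
  have [k0|k0] := atomE _ mk (@subIsetl _ _ _).
    by move: kE; rewrite k0 ltxx.
  apply: le_trans _ (cf_measure_piece K k).
  have UE := setDUK (@subIsetl _ E (piece K k)); rewrite -{1}UE.
  have mDk : measurable (E `\` (E `&` piece K k)) by exact: measurableD.
  apply: (@le_trans _ _ (cf_measure (E `&` piece K k) +
                         cf_measure (E `\` (E `&` piece K k)))%E).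
    exact: measureU2.
  rewrite [X in (_ + X)%E]k0 adde0; apply: le_measure; rewrite ?inE //.
  exact: measurable_piece.
have fE : cf_measure E \is a fin_num.
  by rewrite ge0_fin_numE ?measure_ge0 //; apply: le_lt_trans (Esmall 0) _; rewrite ltry.
move: E0 Esmall; rewrite -(fineK fE) lte_fin => /exists_dyadic_lt[K Kl] /(_ K).
by rewrite lee_fin leNgt Kl.
Qed.

Lemma cf_mp_action : mp_action (@cf_measure R G D) (@cf_act R G (spacer D)).
Proof.
split; [exact: cf_act1|exact: cf_actM|move=> g; split=> [_ E mE|E mE]].
  by rewrite setTI; exact: measurable_act.
exact: cf_measure_act.
Qed.

(** All slices of an invariant set are equal; saturation then says that this
common slice has all dyadic periods, and the zero-one law applies. *)
Lemma cf_ergodic : ergodic (@cf_measure R G D) (@cf_act R G (spacer D)).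
Proof.
move=> E mE invE.
have sliceE g : slice E g = slice E 1%g.
  apply/seteqP; split=> w; rewrite /slice /=.
    by rewrite -{1}(invE g^-1%g) /preimage /= /cf_act /= mulVg.
  by rewrite -{1}(invE g) /preimage /= /cf_act /= mulg1.
have pE : dyadic_periodic (slice E 1%g).
  move=> n w wn.
  have wn' : dyadic n (w + 2 ^- n.+1).
    have := dyadic_lengthS (R := R) n; have := dyadic_length_gt0 (R := R) n.+1.
    by move/dyadicP: wn => wn *; apply/dyadicP; lra.
  have := cutP mE (x := (1%g, w + 2 ^- n.+1)) wn'.
  rewrite /cut /= addrK mul1g ltNge lerDr; move/dyadicP: wn => /andP[-> _] /=.
  rewrite -[E (spacer D n, w)]/(slice E (spacer D n) w) sliceE => EE.
  by apply: iff_sym.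
have m1 := measurable_slice 1%g mE.
have mN (F : set X) : measurable F -> (forall g, slice F g = slice F 1%g) ->
    lambda (slice F 1%g `&` dyadic 0) = 0%E -> cf_measure F = 0%E.
  move=> mF sF F0; apply: cf_measure_eq0 => // g n.
  have -> : slice_measure g n F = lambda (slice F 1%g `&` dyadic n).
    by rewrite -(sF g).
  apply/le_anti/andP; split; last exact: measure_ge0.
  rewrite -[leRHS]F0; apply: le_measure; rewrite ?inE.
  - by apply: measurableI; [exact: measurable_slice|exact: measurable_dyadic].
  - by apply: measurableI; [exact: measurable_slice|exact: measurable_dyadic].
  - by apply: setIS; exact: dyadic_le.
have [E0|E0] := dyadic_zero_one m1 pE; [left|right]; apply: mN => //.
  exact: measurableC.
by move=> g; rewrite -[LHS]/(~` slice E g) sliceE.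
Qed.

End Action.

(** * Failure of the ratio ergodic theorem *)

Lemma integrable_indic_lty d (T : measurableType d) (R : realType)
    (mu : {measure set T -> \bar R}) (A : set T) :
  measurable A -> (mu A < +oo)%E -> mu.-integrable setT (EFin \o \1_A).
Proof.
move=> mA Aoo; apply/integrableP; split; first exact/measurable_realfun.measurable_EFinP.
rewrite (eq_integral (fun x => (\1_A x)%:E)); last first.
  by move=> t _; rewrite /= ger0_norm.
by rewrite integral_indic // setIT.
Qed.

Lemma Rintegral_indic d (T : measurableType d) (R : realType)
    (mu : {measure set T -> \bar R}) (A : set T) :
  measurable A -> \int[mu]_x (\1_A x : R) = fine (mu A).
Proof. by move=> mA; rewrite /Rintegral integral_indic // setIT. Qed.

Lemma orbit_sum_indic d (X : measurableType d) (R : realType) (G : groupType)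
    (T : G -> X -> X) (F : {fset G}) (A : set X) (x : X) :
  orbit_sum T F (\1_A : X -> R) x = (size [seq g <- F | T g x \in A])%:R.
Proof.
rewrite /orbit_sum size_filter -sum1_count natr_sum [RHS]big_mkcond /=.
by apply: eq_bigr => g _; rewrite indicE; case: (_ \in _).
Qed.

Section Criterion.
Context (R : realType) {G : groupType} (D : cf_data G).

Local Notation X := (cf_space R (spacer D)).
Local Notation lambda := (@lebesgue_measure R).
Local Notation mu := (@cf_measure R G D).
Local Notation words := (spacer_words (spacer D) 0).
Local Notation T := (@cf_act R G (spacer D)).

(** Distinct choices of letters give distinct words, because the windows are
disjoint from their translates. *)
Lemma card_spacer_words_eq d : #|` words d| = (2 ^ d)%N.
Proof.
elim: d => [|d IHd] /=; first by rewrite cardfs1.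
have W := @spacer_words_window G D 0 d.
rewrite cardfsU (_ : (_ `&` _)%fset = fset0).
  by rewrite cardfs0 subn0 card_imfset /= ?IHd ?expnS ?mul2n ?addnn //; exact: mulIg.
apply/fsetP => g; rewrite !inE; apply/negbTE/negP.
move=> /andP[/W gw /imfsetP[h /= /W hw ge]].
exact: (window_spacer gw hw).
Qed.

Lemma cf_measure_base0 : mu (base 0) = 1%E.
Proof.
have mb := @measurable_base R G (spacer D) 0.
apply/le_anti/andP; split.
  by have := @cf_measure_base_le R G D 0; rewrite expr0 invr1.
apply: le_trans (window_measure_le 0 mb).
rewrite /window_measure (big_fsetD1 1%g) ?window_one //=.
apply: (@le_trans _ _ (slice_measure 1%g 0 (base (s := spacer D) 0) : \bar R)).
  rewrite /slice_measure (_ : _ `&` _ = dyadic 0).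
    by rewrite lebesgue_dyadic expr0 invr1.
  apply/setIidPr => w w0; split=> //; exists 0%N.
  by rewrite /= inE.
by rewrite leeDl // sume_ge0.
Qed.

Lemma reduce_fst_words n (w : R) : (reduce n ((1%g, w) : X)).1 \in words n.
Proof.
have := @reduce_spacer_words_le R G (spacer D) 0 0 n ((1%g, w) : X) (leq0n n).
by rewrite !add0n; apply; rewrite inE.
Qed.

(** The set [B] is too small to see a spacer of stage [M] or later. *)
Definition spacers_avoid (B : {fset G}) (M : nat) := forall J x y, (M <= J)%N ->
  x \in words J -> y \in words J ->
  (x * spacer D J * y^-1)%g \notin B /\ (x * (spacer D J)^-1 * y^-1)%g \notin B.

(** Returns to [base 0] are quotients of words; if the last letters of the two
words differ, the quotient is one that [B] avoids, and otherwise they cancel. *)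
Lemma avoid_return (B : {fset G}) M h w : spacers_avoid B M -> h \in B ->
  base 0 (T h (1%g, w)) ->
  (h * (reduce M ((1%g, w) : X)).1)%g \in words M.
Proof.
move=> avoid hB /(baseP M)[d Md]; rewrite add0n -(subnK Md) addnC.
rewrite reduce_act [_.1]/=.
elim: (d - M)%N => [|e IHe]; first by rewrite addn0.
rewrite addnS => he; apply: IHe; move: he.
have := reduce_fst_words (M + e) w; rewrite /=; set c := reduce _ _ => cw.
(* The two ways in which the last letters of the words could differ. *)
have [h1 h2] : (forall x, x \in words (M + e) ->
     (h = x * spacer D (M + e) * c.1^-1)%g -> False) /\
   (forall x, x \in words (M + e) ->
     (h = x * (spacer D (M + e))^-1 * c.1^-1)%g -> False).
  split=> x xw hE; have [/negP n1 /negP n2] := avoid _ _ _ (leq_addr e M) xw cw.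
    by apply: n1; rewrite -hE.
  by apply: n2; rewrite -hE.
rewrite /cut; case: ifP => _ /=; rewrite inE => /orP[//|].
- by case/imfsetP => x /= xw xE; case: (h1 x xw); rewrite add0n in xE; rewrite -xE mulgK.
- by move=> hw; case: (h2 _ hw); rewrite mulgA !mulgK.
- by case/imfsetP => x /= xw; rewrite add0n mulgA => /mulIg ->.
Qed.

(** Compare the indicator of [A = base 0] with that of its translate by [a].  At
the given scales a set [B i] sees at most 2^M visits to [A] and at least 2^(M+1)
to the translate, from every point (1, w) with [w] in [0, 1[; these points are
not contained in a null set. *)
Theorem ratio_ergodic_fails (B : nat -> {fset G}) (a : G) :
  (forall i, 1%g \in B i) ->
  (forall N, exists i M, [/\ (N <= i)%N, spacers_avoid (B i) M &
     forall x y, x \in words M.+1 -> y \in words M.+1 ->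
       (a * (x * y^-1))%g \in B i]) ->
  ~ ratio_ergodic_theorem_along R B.
Proof.
move=> B1 scales RET.
pose A : set X := base 0; pose A' : set X := T a^-1%g @^-1` A.
have mA : measurable A by exact: measurable_base.
have mA' : measurable A' by exact: measurable_act.
have muA : mu A = 1%E by exact: cf_measure_base0.
have muA' : mu A' = 1%E by rewrite cf_measure_act.
have iA : (\int[mu]_x (\1_A x : R)) = 1 by rewrite Rintegral_indic // [X in fine X]muA.
have iA' : (\int[mu]_x (\1_A' x : R)) = 1 by rewrite Rintegral_indic // [X in fine X]muA'.
have intA : mu.-integrable setT (EFin \o (\1_A : X -> R)).
  by apply: integrable_indic_lty => //; rewrite [X in (X < _)%E]muA ltry.
have intA' : mu.-integrable setT (EFin \o (\1_A' : X -> R)).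
  by apply: integrable_indic_lty => //; rewrite [X in (X < _)%E]muA' ltry.
have := RET _ X mu T (@cf_non_atomic R G D) (@cf_mp_action R G D)
  (@cf_ergodic R G D) _ _ intA' intA.
rewrite iA iA' divr1 oner_neq0 => /(_ isT)[N [mN N0 badN]].
have good : ~ (slice N 1%g `&` dyadic 0 `<=>` dyadic 0).
  move=> /seteqP NE; have : (slice_measure 1%g 0 N <= mu N)%E.
    apply: le_trans (window_measure_le 0 mN).
    by rewrite /window_measure (big_fsetD1 1%g) ?window_one //= leeDl // sume_ge0.
  by rewrite N0 /slice_measure NE lebesgue_dyadic lee_fin leNgt dyadic_length_gt0.
apply: good; split; first by move=> w [].
move=> w w0; split=> //; apply: badN => /= cvg1.
have one_lt2 : (1 : R) < 2 by rewrite ltr1n.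
have /cvgr_lt/(_ 2 one_lt2)[n0 _ ratio_lt] := cvg1.
have [i [M [n0i avoid near]]] := scales n0.
pose c n := (reduce n ((1%g, w) : X)).1.
have sumA : orbit_sum T (B i) (\1_A : X -> R) (1%g, w) <= (2 ^ M)%:R.
  rewrite orbit_sum_indic ler_nat -card_spacer_words_eq.
  rewrite -[leqRHS](size_map (fun x => x * (c M)^-1)%g); apply: uniq_leq_size.
    by rewrite filter_uniq // fset_uniq.
  move=> h; rewrite mem_filter => /andP[/set_mem hA hB].
  apply/mapP; exists (h * c M)%g; last by rewrite mulgK.
  exact: avoid_return avoid hB hA.
have sumA_gt0 : 0 < orbit_sum T (B i) (\1_A : X -> R) (1%g, w).
  rewrite orbit_sum_indic ltr0n -has_predT; apply/hasP; exists 1%g => //.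
  rewrite mem_filter B1 andbT; apply/mem_set; rewrite cf_act1.
  by split=> //; exists 0%N; rewrite /= inE.
have sumA' : (2 ^ M.+1)%:R <= orbit_sum T (B i) (\1_A' : X -> R) (1%g, w).
  rewrite orbit_sum_indic ler_nat -card_spacer_words_eq.
  rewrite -(size_map (fun x => a * (x * (c M.+1)^-1))%g); apply: uniq_leq_size.
    rewrite map_inj_uniq ?fset_uniq // => x y /mulgI /mulIg; exact.
  move=> _ /mapP[x xw ->]; rewrite mem_filter near //; last exact: reduce_fst_words.
  rewrite andbT; apply/mem_set; rewrite /A' /preimage /= -cf_actM mulKg.
  split=> //; exists M.+1; rewrite add0n reduce_act [_.1]/= -/(c M.+1).
  by rewrite mulgVK.
have := ratio_lt i n0i; rewrite /= => /(_ (lt0r_neq0 sumA_gt0)).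
rewrite /orbit_ratio ltr_pdivrMr // ltNge => /negP; apply.
apply: le_trans sumA'; rewrite expnS natrM.
by rewrite ler_pM2l.
Qed.

End Criterion.

(** * The word metric of the Heisenberg group *)

Section BallTheory.
Context {G : groupType} (S : {fset G}).

Lemma word_ball1 n : 1%g \in word_ball S n.
Proof. by apply/in_word_ball; exists [::]; rewrite big_nil. Qed.

Lemma word_ball_gen x : x \in S -> x \in word_ball S 1.
Proof.
move=> xS; apply/in_word_ball; exists [:: x]; split=> //.
  by move=> y; rewrite inE => /eqP ->.
by rewrite big_seq1.
Qed.

Lemma word_ballM m n g h : g \in word_ball S m -> h \in word_ball S n ->
  (g * h)%g \in word_ball S (m + n).
Proof.
move=> /in_word_ball[s [sm sS ->]] /in_word_ball[t [tn tS ->]].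
apply/in_word_ball; exists (s ++ t); split.
- by rewrite size_cat leq_add.
- by move=> x; rewrite mem_cat => /orP[/sS|/tS].
- by rewrite big_cat.
Qed.

Lemma word_ball_le m n : (m <= n)%N -> {subset word_ball S m <= word_ball S n}.
Proof.
move=> mn g /in_word_ball[s [sm sS ->]]; apply/in_word_ball; exists s; split=> //.
exact: leq_trans mn.
Qed.

Lemma word_ballX n g : g \in S -> (g ^+ n)%g \in word_ball S n.
Proof.
move=> gS; elim: n => [|n IHn]; first by rewrite expg0 word_ball1.
by rewrite expgS -add1n; apply: word_ballM => //; exact: word_ball_gen.
Qed.

End BallTheory.

Lemma heisM k m n k' m' n' :
  (heis k m n * heis k' m' n')%g = heis (k + k') (m + m' + k * n') (n + n').
Proof. by apply: val_inj; rewrite /= heis_mxM. Qed.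

Lemma heis1 : 1%g = heis 0 0 0.
Proof. by apply: val_inj; rewrite /= heis_mx1. Qed.

Lemma heisV k m n : (heis k m n)^-1%g = heis (- k) (k * n - m) (- n).
Proof.
apply: (@mulgI _ (heis k m n)); rewrite mulgV heis1 heisM.
by congr heis; ring.
Qed.

Lemma heis_inj k m n k' m' n' : heis k m n = heis k' m' n' ->
  [/\ k = k', m = m' & n = n'].
Proof.
move=> /(congr1 heis_val) /= /matrixP h.
by have := (h 0 1, h 0 2, h 1 2); rewrite !mxE /= => -[[-> ->] ->].
Qed.

Definition heis_c (t : int) : heisenberg := heis 0 t 0.

Lemma heis_cD s t : (heis_c s * heis_c t)%g = heis_c (s + t).
Proof. by rewrite heisM mul0r !addr0. Qed.

Lemma heis_cV t : (heis_c t)^-1%g = heis_c (- t).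
Proof. by rewrite heisV mul0r oppr0 sub0r. Qed.

Lemma heis_gensP x : x \in heis_gens ->
  exists e : int, (e = 1 \/ e = -1) /\ (x = heis e 0 0 \/ x = heis 0 0 e).
Proof.
rewrite !inE /heis_a /heis_b !heisV => /orP[/orP[/orP[]|]|] /eqP ->;
  [exists 1|exists (-1)|exists 1|exists (-1)]; (split; [by auto|]);
  rewrite ?mul0r ?mulr0 ?subr0 ?oppr0; auto.
Qed.

(** A path in the plane that uses [q] steps up and [r] steps down and whose
abscissas stay in [lo, hi] has signed area [t] between the obvious bounds, and the
number [P] of its horizontal steps controls hi - lo, with a saving given by the
abscissa [k] of its end. *)
Lemma heis_area (w : seq heisenberg) : {in w, forall x, x \in heis_gens} ->
  exists k m t lo hi P q r : int, [/\ (\prod_(x <- w) x)%g = heis k t m,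
    lo <= 0 <= hi /\ lo <= k <= hi, 2 * (hi - lo) <= P + `|k|,
    0 <= q /\ 0 <= r & [/\ P + q + r <= (size w)%:Z, q - r = m &
    q * lo - r * hi <= t <= q * hi - r * lo]].
Proof.
elim/last_ind: w => [|w x IHw] wS.
  exists 0, 0, 0, 0, 0, 0, 0, 0; rewrite big_nil heis1; split => //.
have [|k [m [t [lo [hi [P [q [r]]]]]]]] := IHw.
  by move=> y yw; apply: wS; rewrite mem_rcons inE yw orbT.
case=> wE [lohi0 lohik] area [q0 r0] [len qr bnd].
have [e [eE xE]] : exists e : int, (e = 1 \/ e = -1) /\
    (x = heis e 0 0 \/ x = heis 0 0 e).
  by apply: heis_gensP; apply: wS; rewrite mem_rcons mem_head.
rewrite size_rcons -cats1 big_cat big_seq1 /= wE.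
case: xE => ->; rewrite heisM.
(* A horizontal step may enlarge the range of abscissas. *)
- exists (k + e), m, t, (Num.min lo (k + e)), (Num.max hi (k + e)), (P + 1), q, r.
  split; [by congr heis; ring|by lia|by lia|by []|split=> //; first by lia].
  apply/andP; split.
    apply: le_trans (andP bnd).1; apply: lerB; apply: ler_wpM2l => //; lia.
  apply: le_trans (andP bnd).2 _; apply: lerB; apply: ler_wpM2l => //; lia.
- exists k, (m + e), (t + k * e), lo, hi, P,
    (if e == 1 then q + 1 else q), (if e == 1 then r else r + 1).
  case: eE => -> /=; (split; [by congr heis; ring|by []|by []|by lia|]);
    (split; [by lia|by lia|rewrite ?mulr1 ?mulrN1 !mulrDl ?mul1r; lia]).
Qed.

(** For a closed path q = r and 2 (hi - lo) <= P, so that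
|t| <= q (hi - lo) <= q P / 2 <= (2 q + P)^2 / 16. *)
Lemma heis_c_isoperimetric n t : heis_c t \in word_ball heis_gens n ->
  16 * `|t| <= n%:Z ^+ 2.
Proof.
move=> /in_word_ball[w [wn wS]].
have [k [m [t' [lo [hi [P [q [r]]]]]]]] := heis_area wS.
case=> -> [lohi0 _] area [q0 r0] [len qr bnd] /heis_inj[k0 tE m0]; subst k t' m.
have rq : r = q by lia.
subst r.
have b1 : `|t| <= q * (hi - lo).
  by move: bnd; rewrite mulrBr; lia.
have b2 : 2 * q + P <= n%:Z.
  have : (size w)%:Z <= n%:Z by rewrite lez_nat.
  move: len; set sw := (size w)%:Z. lia.
have b3 : 2 * (hi - lo) <= P by move: area; rewrite normr0 addr0.
have b4 : 16 * (q * (hi - lo)) <= (2 * q + P) ^+ 2.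
  have h := ler_wpM2l q0 b3; have : 0 <= (2 * q - P) ^+ 2 by rewrite sqr_ge0.
  rewrite !expr2; lia.
have b5 : (2 * q + P) ^+ 2 <= n%:Z ^+ 2 by rewrite lerXn2r // nnegrE; lia.
lia.
Qed.

Lemma heis_aX n : (heis_a ^+ n)%g = heis n%:Z 0 0.
Proof.
elim: n => [|n IHn]; first by rewrite expg0 heis1.
by rewrite expgS IHn heisM; congr heis; lia.
Qed.

Lemma heis_bX n : (heis_b ^+ n)%g = heis 0 0 n%:Z.
Proof.
elim: n => [|n IHn]; first by rewrite expg0 heis1.
by rewrite expgS IHn heisM; congr heis; lia.
Qed.

(** * The spacers for given radii *)

Lemma heis_gensV x : x \in heis_gens -> (x^-1)%g \in heis_gens.
Proof.
rewrite !inE => /orP[/orP[/orP[]|]|] /eqP ->; rewrite ?invgK eqxx ?orbT //.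
Qed.

Lemma heis_ballV n g : g \in word_ball heis_gens n ->
  (g^-1)%g \in word_ball heis_gens n.
Proof.
move=> /in_word_ball[w [wn wS ->]]; apply/in_word_ball.
exists [seq (x^-1)%g | x <- rev w]; split; first by rewrite size_map size_rev.
  by move=> _ /mapP[x + ->]; rewrite mem_rev => /wS/heis_gensV.
by rewrite big_map prodgV revK.
Qed.

Lemma int_signP (z : int) : exists (e : bool) (s : nat), z = (-1) ^+ e * s%:Z.
Proof.
case: (intP z) => [|s|s];
  [exists false, 0%N|exists false, s.+1|exists true, s.+1];
  by rewrite ?expr0 ?expr1 ?mul1r ?mulN1r.
Qed.

Lemma heis_ball_a (e : bool) (k : nat) :
  heis ((-1) ^+ e * k%:Z) 0 0 \in word_ball heis_gens k.
Proof.
have := @word_ballX _ heis_gens k heis_a; rewrite heis_aX => h.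
have {h} : heis k%:Z 0 0 \in word_ball heis_gens k by apply: h; rewrite !inE eqxx.
case: e => [/heis_ballV|]; last by rewrite expr0 mul1r.
by rewrite heisV mulr0 oppr0 subr0 expr1 mulN1r.
Qed.

Lemma heis_ball_b (e : bool) (k : nat) :
  heis 0 0 ((-1) ^+ e * k%:Z) \in word_ball heis_gens k.
Proof.
have := @word_ballX _ heis_gens k heis_b; rewrite heis_bX => h.
have {h} : heis 0 0 k%:Z \in word_ball heis_gens k.
  by apply: h; rewrite !inE eqxx !orbT.
case: e => [/heis_ballV|]; last by rewrite expr0 mul1r.
by rewrite heisV mul0r oppr0 subr0 expr1 mulN1r.
Qed.

(** The path runs around a rectangle of sides [p] and [q], leaving out [D] of its
horizontal steps: left by [p - D], down by [q], and up while moving right.  The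
heights at which it moves right adjust the area to any prescribed value; the
exponent [e] reflects the path in order to change the sign of the area. *)
Lemma heis_reach (D p q n : nat) (t : int) : (D <= p)%N ->
  (2 * p + 2 * q <= n + D)%N -> `|t| < (p * q)%:Z ->
  heis D%:Z t 0 \in word_ball heis_gens n.
Proof.
move=> Dp pqn tpq.
have [e [s tE]] := int_signP t.
have spq : (s < p * q)%N.
  by move: tpq; rewrite tE normrM normrX normrN1 expr1n mul1r.
have p0 : (0 < p)%N by case: (p) spq.
pose v := (s %/ p)%N; pose r := (s %% p)%N.
have rp : (r < p)%N by rewrite ltn_mod.
have vq : (v < q)%N by rewrite ltn_divLR // mulnC.
have sE : s = (v * p + r)%N by exact: divn_eq.
have -> : heis D%:Z t 0 =
  (heis ((-1) ^+ true * (p - D)%N%:Z) 0 0 *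
   (heis 0 0 ((-1) ^+ (~~ e) * q%:Z) *
   (heis 0 0 ((-1) ^+ e * (q - v.+1)%N%:Z) *
   (heis ((-1) ^+ false * r%:Z) 0 0 *
   (heis 0 0 ((-1) ^+ e * 1%N%:Z) *
   (heis ((-1) ^+ false * (p - r)%N%:Z) 0 0 *
    heis 0 0 ((-1) ^+ e * v%:Z)))))))%g.
  rewrite !heisM tE sE -!subzn ?(ltnW rp) // PoszD PoszM -[v.+1]addn1 PoszD.
  by case: e {tE}; rewrite ?expr0 ?expr1; congr heis; ring.
apply: (@word_ball_le _ _ ((p - D) + (q + ((q - v.+1) + (r + (1 + ((p - r) + v)))))));
  first lia.
by repeat (apply: word_ballM;
  [by [exact: heis_ball_a|exact: heis_ball_b]|]); exact: heis_ball_b.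
Qed.

Lemma heis_in_ball g : exists n, g \in word_ball heis_gens n.
Proof.
have [k [m [n ->]]] := heisE g.
have -> : heis k m n = (heis k 0 0 * (heis 0 0 n * heis 0 (m - k * n) 0))%g.
  by rewrite !heisM; congr heis; ring.
have [e [a ->]] := int_signP k; have [f [b ->]] := int_signP n.
set t := (X in heis 0 X 0); pose c := `|t|%N.
exists (a + (b + (2 * c.+1 + 2 * 1)))%N.
apply: word_ballM; first exact: heis_ball_a.
apply: word_ballM; first exact: heis_ball_b.
apply: (@heis_reach 0 c.+1 1); rewrite ?addn0 //; lia.
Qed.

Section Scales.
Variables (u : nat -> nat).
Hypothesis u_ge : forall i, (i <= u i)%N.

(** A bound for the exponents of [c] in the words used so far, and the radius of
the current window.  The next scale is so large that both are negligible before
it. *)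
Fixpoint state (M : nat) : nat * nat :=
  if M is M'.+1 then
    let: (sigma, r) := state M' in
    let n := u (16 * sigma + 2 * r + 12) in
    ((((n + 4) %/ 4) ^ 2).-1, 2 * r + n + 4)%N
  else (0, 0)%N.

Definition height M := (state M).1.
Definition window_radius M := (state M).2.
Definition scale M := (16 * height M + 2 * window_radius M + 12)%N.
Definition radius M := u (scale M).
(** The side of the square spanned by the paths of [heis_reach] that end at [a^4]
and have length at most [radius M]. *)
Definition side M := ((radius M + 4) %/ 4)%N.
Definition jump M : nat := ((side M ^ 2).-1 - height M)%N.

Lemma heightS M : height M.+1 = (side M ^ 2).-1.
Proof. by rewrite /side /radius /scale /height /window_radius /=; case: (state M). Qed.

Lemma window_radiusS M :
  window_radius M.+1 = (2 * window_radius M + radius M + 4)%N.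
Proof. by rewrite /radius /scale /height /window_radius /=; case: (state M). Qed.

Lemma radius_ge M : (16 * height M + 2 * window_radius M + 12 <= radius M)%N.
Proof. exact: u_ge. Qed.

Lemma side_bound M : (4 * side M <= radius M + 4 < 4 * side M + 4)%N.
Proof. by rewrite /side; lia. Qed.

(** The area of the square exceeds radius^2 / 16 by more than twice the exponents used
before, which leaves room for the next spacer. *)
Lemma side_sq M : (radius M ^ 2 + 32 * height M + 16 < 16 * side M ^ 2)%N.
Proof.
have h1 := radius_ge M; have h2 := side_bound M.
have : ((radius M + 1) ^ 2 <= (4 * side M) ^ 2)%N by rewrite leq_sqr; lia.
rewrite -!mulnn; nia.
Qed.

Lemma heightD M : height M.+1 = (height M + jump M)%N.
Proof. by rewrite heightS /jump; have := side_sq M; lia. Qed.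

Lemma jump_gt M : (radius M ^ 2 < 16 * (jump M - height M))%N.
Proof. by rewrite /jump; have := side_sq M; lia. Qed.

Lemma radius_mono M J : (M <= J)%N -> (radius M <= radius J)%N.
Proof.
elim: J => [|J IHJ]; first by rewrite leqn0 => /eqP ->.
rewrite leq_eqVlt => /predU1P[-> //|/IHJ/leq_trans]; apply.
have := radius_ge J.+1; have := window_radiusS J; lia.
Qed.

Lemma window_radius_ge M : (M <= window_radius M)%N.
Proof. elim: M => // M; rewrite window_radiusS; lia. Qed.

Definition heis_spacer M := heis_c (jump M)%:Z.
Definition heis_window M := word_ball heis_gens (window_radius M).

Lemma far_from_ball M (t : int) : (jump M - height M)%N%:Z <= `|t| ->
  heis_c t \notin word_ball heis_gens (radius M).
Proof.
move=> tM; apply/negP => /heis_c_isoperimetric.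
have := jump_gt M; rewrite expr2 -mulnn; lia.
Qed.

Lemma heis_spacer_ball M : heis_spacer M \in word_ball heis_gens (radius M + 4).
Proof.
have -> : heis_spacer M = (heis ((-1) ^+ true * 4%N%:Z) 0 0 *
                           heis 4%N%:Z (jump M) 0)%g.
  by rewrite heisM /heis_spacer; congr heis; ring.
rewrite addnC; apply: word_ballM; first exact: heis_ball_a.
have h := side_bound M; have h1 := radius_ge M; have h2 := side_sq M.
apply: (@heis_reach 4 (side M) (side M)); [lia|lia|].
rewrite /jump mulnn; lia.
Qed.

Lemma heis_window_spacer n g h : g \in heis_window n -> h \in heis_window n ->
  g <> (h * heis_spacer n)%g.
Proof.
move=> gn hn gE.
have : heis_spacer n \in word_ball heis_gens (window_radius n + window_radius n).
  rewrite -(mulKg h (heis_spacer n)) -gE; apply: word_ballM => //.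
  exact: heis_ballV.
have rn := radius_ge n.
move/(@word_ball_le _ _ _ (radius n)) => /(_ ltac:(lia)); apply/negP.
by apply: far_from_ball; lia.
Qed.

Lemma heis_window_sub n g : g \in heis_window n ->
  g \in heis_window n.+1 /\ (g * heis_spacer n)%g \in heis_window n.+1.
Proof.
move=> gn; rewrite /heis_window window_radiusS; split.
  by apply: word_ball_le gn; lia.
apply: word_ball_le (word_ballM gn (heis_spacer_ball n)); lia.
Qed.

Lemma heis_window_absorb h : exists N, forall n, (N <= n)%N ->
  forall g, g \in heis_window n ->
  (h * g)%g \in heis_window n.+1 /\ (h * g * heis_spacer n)%g \in heis_window n.+1.
Proof.
have [N hN] := heis_in_ball h; exists N => n Nn g gn.
have := window_radius_ge n; rewrite /heis_window window_radiusS => rn; split.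
  by apply: word_ball_le (word_ballM hN gn); lia.
apply: word_ball_le (word_ballM (word_ballM hN gn) (heis_spacer_ball n)); lia.
Qed.

Definition heis_data : cf_data heisenberg :=
  @CFData _ heis_spacer heis_window (word_ball1 heis_gens (window_radius 0))
    heis_window_spacer heis_window_sub heis_window_absorb.

Lemma heis_spacer_wordsP J x : x \in spacer_words heis_spacer 0 J ->
  exists2 t : int, 0 <= t <= (height J)%:Z & x = heis_c t.
Proof.
elim: J x => [|J IHJ] x /=; first by rewrite inE => /eqP ->; exists 0; rewrite ?heis1.
rewrite inE => /orP[/IHJ[t tJ ->]|/imfsetP[y /= /IHJ[t tJ ->] ->]].
  by exists t => //; rewrite heightD; lia.
rewrite add0n /heis_spacer heis_cD; exists (t + jump J) => //.
by rewrite heightD; lia.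
Qed.

Lemma heis_spacers_avoid M :
  spacers_avoid heis_data (word_ball heis_gens (radius M)) M.
Proof.
move=> J x y MJ /heis_spacer_wordsP[t tJ ->] /heis_spacer_wordsP[t' tJ' ->].
have sub := word_ball_le (S := heis_gens) (radius_mono MJ).
rewrite /= /heis_spacer !heis_cV !heis_cD.
have ge : (height J <= jump J)%N by have := jump_gt J; lia.
by split; apply/negP => /sub; apply/negP; apply: far_from_ball; lia.
Qed.

Lemma heis_near M x y : x \in spacer_words heis_spacer 0 M.+1 ->
  y \in spacer_words heis_spacer 0 M.+1 ->
  (heis 4%N%:Z 0 0 * (x * y^-1))%g \in word_ball heis_gens (radius M).
Proof.
move=> /heis_spacer_wordsP[t tM ->] /heis_spacer_wordsP[t' tM' ->].
rewrite heis_cV heis_cD heisM mulr0 !addr0 add0r.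
have h := side_bound M; have h1 := radius_ge M; have h2 := side_sq M.
apply: (@heis_reach 4 (side M) (side M)); [lia|lia|].
move: tM tM'; rewrite heightS mulnn; lia.
Qed.

End Scales.

Theorem mainTheorem5 (R : realType) :
  ~ exists u : nat -> nat,
      {homo u : i j / (i < j)%N} /\
      ratio_ergodic_theorem_along R (fun i : nat => word_ball heis_gens (u i)).
Proof.
move=> [u [u_incr]].
have u_ge i : (i <= u i)%N.
  by elim: i => // i IHi; exact: leq_ltn_trans IHi (u_incr _ _ (ltnSn i)).
apply: (ratio_ergodic_fails (D := heis_data u_ge) (a := heis 4%N%:Z 0 0)).
  by move=> i; exact: word_ball1.
(* [scale u N] exceeds [N], so stage [N] provides an index beyond [N]. *)
move=> N; exists (scale u N), N; split.
- by have := window_radius_ge u N; rewrite /scale; lia.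
- exact: heis_spacers_avoid.
- exact: heis_near.
Qed.
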